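(* There exists a countable congruence-free Hausdorff locally compact Polish topological inverse semigroup $S$ with a compact semilattice of idempotents which cannot be topologically embedded into $\mathbb{N}^{\mathbb{N}}$.
   Context: A semigroup is congruence-free if it admits only the trivial (diagonal and universal) two-sided congruences. An inverse semigroup is a semigroup $S$ such that for each $x\in S$ there is a unique $x^{-1}\in S$ with $xx^{-1}x=x$ and $x^{-1}xx^{-1}=x^{-1}$. A topological inverse semigroup is an inverse semigroup with a topology for which both multiplication and inversion are continuous. The semilattice of idempotents is $E(S)=\{e\in S: e^2=e\}$ with the subspace topology. $\mathbb{N}^{\mathbb{N}}$ is the monoid of all functions $\mathbb{N}\to\mathbb{N}$ under composition (functions act on the right and compose from left to right), with the product topology arising from the discrete topology on $\mathbb{N}$. A topological embedding of a topological semigroup $S$ into a topological semigroup $T$ is an injective homomorphism $\phi:S\to T$ such that $\phi$ and $\phi^{-1}:(S)\phi\to S$ are continuous, where $(S)\phi$ has the subspace topology. *)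

(* Defs.v *)
From HB Require Import structures.
From mathcomp Require Import all_boot all_algebra.
From mathcomp Require Import all_classical all_reals all_analysis.
From Stdlib Require RelationClasses.

Set Implicit Arguments.
Unset Strict Implicit.
Unset Printing Implicit Defensive.

Local Open Scope classical_set_scope.
Local Open Scope group_scope.

HB.structure Definition PreTopologicalSemigroup :=
  {S of Topological S & Semigroup S}.

HB.mixin Record PreTopologicalSemigroup_isTopologicalSemigroup S
    & PreTopologicalSemigroup S := {
  mulg_continuous : continuous (fun x : S * S => x.1 * x.2)
}.

#[short(type="topologicalSemigroupType")]
HB.structure Definition TopologicalSemigroup :=
  {S of PreTopologicalSemigroup S
      & PreTopologicalSemigroup_isTopologicalSemigroup S}.

(* The inverse is part of the structure, but it is determined by the
   multiplication ([sinv_unique]). The library's [^-1] is not used because its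
   carrier must have a distinguished unit. *)
HB.mixin Record Semigroup_isInverseSemigroup S & Semigroup S := {
  sinv : S -> S;
  mulgVg : forall x : S, x * sinv x * x = x;
  mulVgV : forall x : S, sinv x * x * sinv x = sinv x;
  sinv_unique : forall x y : S, x * y * x = x -> y * x * y = y -> y = sinv x
}.

#[short(type="inverseSemigroupType")]
HB.structure Definition InverseSemigroup :=
  {S of Semigroup S & Semigroup_isInverseSemigroup S}.

HB.structure Definition PreTopologicalInverseSemigroup :=
  {S of TopologicalSemigroup S & InverseSemigroup S}.

HB.mixin Record PreTopologicalInverseSemigroup_isTopologicalInverseSemigroup S
    & PreTopologicalInverseSemigroup S := {
  sinv_continuous : continuous (@sinv S)
}.

#[short(type="topologicalInverseSemigroupType")]
HB.structure Definition TopologicalInverseSemigroup :=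
  {S of PreTopologicalInverseSemigroup S
      & PreTopologicalInverseSemigroup_isTopologicalInverseSemigroup S}.

Definition idempotents (S : semigroupType) : set S := [set e | e * e = e].
Arguments idempotents : clear implicits.

Definition congruence (S : semigroupType) (r : S -> S -> Prop) : Prop :=
  RelationClasses.Equivalence r /\
  forall x y z : S, r x y -> r (z * x) (z * y) /\ r (x * z) (y * z).

Definition congruence_free (S : semigroupType) : Prop :=
  forall r : S -> S -> Prop, congruence r ->
    (forall x y, r x y <-> x = y) \/ (forall x y, r x y).

Definition separable (T : topologicalType) : Prop :=
  exists2 D : set T, countable D & dense D.

Definition homeomorphic (T U : topologicalType) : Prop :=
  exists (f : T -> U) (g : U -> T),
    [/\ cancel f g, cancel g f, continuous f & continuous g].

(* Unlike [completeType], this does not ask for a distinguished point. *)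
Definition complete_space (M : uniformType) : Prop :=
  forall F : set_system M, ProperFilter F -> cauchy F -> exists x : M, F --> x.

Definition polish (R : realType) (T : topologicalType) : Prop :=
  exists M : metricType R,
    [/\ separable M, complete_space M & homeomorphic T M].

(* [range phi] is coerced to a type, which carries the subspace topology. *)
Definition topological_embedding (S T : topologicalSemigroupType)
    (phi : {multiplicative S -> T}) : Prop :=
  [/\ injective phi, continuous phi &
      exists psi : range phi -> S,
        (forall y, phi (psi y) = \val y) /\ continuous psi].

Definition topologically_embeddable (S T : topologicalSemigroupType) : Prop :=
  exists phi : {multiplicative S -> T}, topological_embedding phi.

Definition natnat : Type := {ptws nat -> nat}.

HB.instance Definition _ := Topological.copy natnat {ptws nat -> nat}.

(* Functions act on the right: f * g is f followed by g. *)
Definition natnat_mul (f g : natnat) : natnat := fun n => g (f n).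

Fact natnat_mulA : associative natnat_mul. Proof. by []. Qed.

HB.instance Definition _ := isSemigroup.Build natnat natnat_mulA.

Fact natnat_mul1g : left_id (id : natnat) *%g. Proof. by []. Qed.

Fact natnat_mulg1 : right_id (id : natnat) *%g. Proof. by []. Qed.

HB.instance Definition _ :=
  Semigroup_isMonoid.Build natnat natnat_mul1g natnat_mulg1.

Fact natnat_mul_continuous :
  continuous (fun x : natnat * natnat => x.1 * x.2).
Proof.
have evalE (f : natnat) n : \forall g \near f, g n = f n.
  have /(_ f [set f n]) := @proj_continuous nat (fun=> nat) n.
  by apply; rewrite nbhs_principalE; exact/principal_filterP.
move=> [f g]; apply/(@pointwise_cvgP nat nat) => n /= U.
rewrite nbhs_principalE => /principal_filterP Ufgn.
exists ([set h | h n = f n], [set k : natnat | k (f n) = g (f n)]).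
  by split; exact: evalE.
move=> [h k] /= [hn kfn]; change (U (k (h n))).
by rewrite hn kfn.
Qed.

HB.instance Definition _ :=
  PreTopologicalSemigroup_isTopologicalSemigroup.Build natnat
    natnat_mul_continuous.

(* Main.v *)
From HB Require Import structures.
Require Import Defs.
From mathcomp Require Import all_boot all_order all_algebra.
From mathcomp Require Import all_classical all_reals all_analysis.

Local Open Scope classical_set_scope.

Import Order.TTheory GRing.Theory Num.Theory.

(** The example is the semigroup of matrix units indexed by the natural
    numbers: a zero and elements [(i, j)] with [(i, j) * (j, l) = (i, l)], all
    other products being zero. Its idempotents are zero and the [(i, i)], and
    inversion is transposition. Any two distinct elements can be separated by
    multiplying on both sides so that one becomes zero and the other does not;
    from there multiplication by units relates everything to zero, so the
    semigroup is congruence-free ([matrix_units_congruence_free]).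

    Its topology makes every unit isolated and takes, as neighbourhoods of zero,
    the sets that contain zero and all but finitely many [(i, i)]
    ([nbhs_unit], [nbhs_zero]). The set of idempotents is therefore open, and it
    is a convergent sequence together with its limit: hence compact, which also
    gives local compactness. The topology comes from a complete ultrametric in
    which the distance of two distinct points is the larger of their weights,
    the weight of [(i, i)] being [1 / (i + 1)], that of zero being 0 and that of
    any other unit being 1.

    The obstruction to an embedding [phi] is that convergence in the monoid of
    functions is absorbed on the right: if [f n] tends to [h] then, at a given
    point [k], [f n] and [h] eventually agree exactly, so that [f n * g n] and
    [h * g n] agree at [k] for large [n], whatever the functions [g n]
    ([natnat_cvg_absorb]). The idempotents [e n = (n, n)] tend to zero; with
    [u n = (n, n + 1)] one has [e n * u n = u n] and [0 * u n = 0], so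
    [phi (u n)] must tend to [phi 0]. But no [u n] lies in the neighbourhood of
    zero formed by the idempotents, so [phi] has no continuous inverse. *)

(** * Two topological lemmas *)

(** In a discrete space convergence is eventual equality, so at a given [k] and
    for large [n] the product [f n * g n] evaluates [g n] at exactly the same
    point [h k] as [h * g n] does. *)
Lemma natnat_cvg_absorb (f g : nat -> natnat) (h : natnat) :
  f @ \oo --> h -> (forall n, (h * g n)%g = h) ->
  (fun n => (f n * g n)%g) @ \oo --> h.
Proof.
move=> fh hg; apply/(@pointwise_cvgP nat nat) => k.
move/(@pointwise_cvgP nat nat): fh => /(_ k) fk.
have evk : \forall n \near \oo, f n k = h k.
  by apply: (fk [set h k]); rewrite nbhs_principalE; exact/principal_filterP.
move=> A /=; rewrite nbhs_principalE => /principal_filterP Ah.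
apply: filterS evk => n fnk; change (A (g n (f n k))).
have ghk : g n (h k) = h k by have := congr1 (fun u : natnat => u k) (hg n).
by rewrite fnk ghk.
Qed.

(** A filter on [K] that does not cluster at [x] lives on a finite part of [K],
    where it must cluster. *)
Lemma compact_almost_convergent (T : topologicalType) (K : set T) (x : T) :
  K x -> (forall B, nbhs x B -> finite_set (K `\` B)) -> compact K.
Proof.
move=> Kx finK F FF FK.
have [Fx|/existsNP[A /existsNP[B]]] := pselect (cluster F x); first by exists x.
move=> /not_implyP[FA /not_implyP[xB AB]].
have cK : compact (K `\` B) by exact/finite_compact/finK.
have [|y [[Ky _] Fy]] := cK F FF; last by exists y.
apply: filterS (filterI FK FA) => y [Ky Ay]; split=> // By.
by apply: AB; exists y.
Qed.

(** * The semigroup of matrix units *)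

(** [None] is the zero and [Some (i, j)] is the matrix with a single entry 1 in
    position [(i, j)]. [R] is where the metric put on this carrier takes its
    values. *)
Definition matrix_units (R : realType) : Type := option (nat * nat).

Section matrix_units.
Variable R : realType.
Local Notation S := (matrix_units R).
Implicit Types x y z : S.

HB.instance Definition _ := Choice.on S.

Let mul x y : S :=
  match x, y with
  | Some (i, j), Some (k, l) => if j == k then Some (i, l) else None
  | _, _ => None
  end.

Let mulA : associative mul.
Proof.
by case=> [[i j]|] [[k l]|] [[m n]|] //=; repeat (case: eqP => //= ?).
Qed.

HB.instance Definition _ := isSemigroup.Build S mulA.

Lemma mul_unit (i j k l : nat) :
  ((Some (i, j) : S) * (Some (k, l) : S))%g =
  (if j == k then Some (i, l) else None) :> S.
Proof. by []. Qed.

Lemma mul0u x : ((None : S) * x)%g = None.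
Proof. by case: x. Qed.

Lemma mulu0 x : (x * (None : S))%g = None.
Proof. by case: x => [[]|]. Qed.

Let inv x : S := if x is Some (i, j) then Some (j, i) else None.

Let mulVg x : (x * inv x * x)%g = x.
Proof. by case: x => [[i j]|] //=; rewrite !mul_unit eqxx mul_unit eqxx. Qed.

Let invMK x : (inv x * x * inv x)%g = inv x.
Proof. by case: x => [[i j]|] //=; rewrite !mul_unit eqxx mul_unit eqxx. Qed.

Let inv_unique x y : (x * y * x)%g = x -> (y * x * y)%g = y -> y = inv x.
Proof.
case: x y => [[i j]|] [[k l]|]; rewrite ?(mulu0, mul0u) //= mul_unit.
case: eqP => [->|_]; rewrite ?mul0u // mul_unit.
by case: eqP => [->|].
Qed.

HB.instance Definition _ := Semigroup_isInverseSemigroup.Build S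
  mulVg invMK inv_unique.

Lemma idempotentsP x :
  idempotents S x <-> (x = None \/ exists i, x = Some (i, i)).
Proof.
split=> [|[->|[i ->]]]; rewrite /idempotents/= ?mul_unit ?eqxx //.
case: x => [[i j]|]; last by left.
by rewrite mul_unit; case: eqP => // -> _; right; exists i.
Qed.

(** If [x = (i, j)] is related to [y <> x], then multiplying by [(i, i)] on the
    left and [(j, j)] on the right fixes [x] and kills [y], so [x] is related to
    zero; since [(k, i) * x * (j, l) = (k, l)], so is everything else. *)
Lemma matrix_units_congruence_free : congruence_free S.
Proof.
move=> r [[rr rs rt] rM].
have r0_full i j : r (Some (i, j)) None -> forall x y, r x y.
  move=> ij0; have all0 x : r x None.
    case: x => [[k l]|]; last exact: rr.
    have /(rM _ _ (Some (j, l)))[_] := (rM _ _ (Some (k, i)) ij0).1.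
    by rewrite !mul_unit eqxx mulu0 mul0u mul_unit eqxx.
  by move=> x y; apply: rt (all0 x) (rs _ _ (all0 y)).
have full x y : r x y -> x <> y -> forall x y, r x y.
  move=> rxy xy.
  (* At most one of [x] and [y] is zero; by symmetry let [x] be a unit. *)
  wlog [i [j xij]] : x y rxy xy / exists i j, x = Some (i, j).
    move=> H; case: x y rxy xy => [[i j]|] y rxy xy.
      by apply: (H (Some (i, j)) y) => //; exists i, j.
    case: y rxy xy => [[i j]|] // rxy xy.
    by apply: (H (Some (i, j)) None); [exact: rs| |exists i, j].
  have := (rM _ _ (Some (j, j)) (rM _ _ (Some (i, i)) rxy).1).2.
  rewrite {}xij in rxy xy *; rewrite !mul_unit eqxx mul_unit eqxx.
  suff -> : ((Some (i, i) : S) * y * (Some (j, j) : S))%g = None.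
    exact: r0_full.
  case: y rxy xy => [[k l]|] // _ kl; rewrite mul_unit.
  case: eqP => // ik; rewrite mul_unit; case: eqP => // lj.
  by case: kl; rewrite ik lj.
have [[x [y [rxy xy]]]|H] := pselect (exists x y, r x y /\ x <> y).
  by right; exact: full rxy xy.
left=> x y; split=> [rxy|->]; last exact: rr.
by apply: contrapT => xy; apply: H; exists x, y.
Qed.

(** * The topology *)

Local Open Scope ring_scope.

Let weight x : R :=
  if x is Some (i, j) then if i == j then i.+1%:R^-1 else 1 else 0.

Let weight_gt0 p : 0 < weight (Some p).
Proof. by case: p => i j /=; case: ifP => // _; rewrite invr_gt0 ltr0n. Qed.

Let weight_ge0 x : 0 <= weight x.
Proof. by case: x => // p; exact/ltW/weight_gt0. Qed.

(** The ultrametric of a star with centre zero and one branch for each unit: the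
    ball around a unit whose radius is the weight of that unit is a single
    point. *)
Let dist x y : R := if x == y then 0 else Num.max (weight x) (weight y).

Let distxx x : dist x x = 0. Proof. by rewrite /dist eqxx. Qed.

Let dist_eq0 x y : dist x y = 0 -> x = y.
Proof.
rewrite /dist; case: eqP => // xy d0.
have : weight x <= 0 /\ weight y <= 0.
  by rewrite -[X in _ <= X /\ _]d0 -[X in _ /\ _ <= X]d0 !le_max !lexx orbT.
case: x y {d0} xy => [p|] [q|] // _ [].
- by rewrite leNgt weight_gt0.
- by rewrite leNgt weight_gt0.
- by move=> _; rewrite leNgt weight_gt0.
Qed.

Let dist_sym x y : dist x y = dist y x.
Proof. by rewrite /dist eq_sym maxC. Qed.

Let dist_triangle y x z : dist x z <= dist x y + dist y z.
Proof.
rewrite /dist; case: (x =P z) => [_|xz].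
  by rewrite addr_ge0//; case: ifP => // _; rewrite le_max weight_ge0.
have [<-|xy] := eqVneq x y; first by rewrite add0r; case: eqP.
have [<-|yz] := eqVneq y z; first by rewrite addr0.
rewrite ge_max; apply/andP; split.
  by rewrite (le_trans (y := Num.max (weight x) (weight y))) ?le_max ?lexx//
     lerDl le_max weight_ge0.
by rewrite (le_trans (y := Num.max (weight y) (weight z))) ?le_max ?lexx ?orbT//
     lerDr le_max weight_ge0.
Qed.

HB.instance Definition _ := isMetric.Build R S
  distxx dist_eq0 dist_sym dist_triangle.

Let ballE x e y : ball x e y <-> dist x y < e.
Proof. by []. Qed.

Lemma nbhs_unit p (A : set S) : nbhs (Some p : S) A <-> A (Some p).
Proof.
split=> [/nbhs_singleton//|Ap].
apply/nbhs_ballP; exists (weight (Some p)) => /=; first exact: weight_gt0.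
move=> y /ballE; rewrite /dist; case: eqP => [<- //|_].
by rewrite gt_max ltxx.
Qed.

Lemma nbhs_zero (A : set S) : nbhs (None : S) A <->
  A None /\ \forall i \near \oo, A (Some (i, i)).
Proof.
split=> [A0|[A0 [n _ An]]].
  split; first exact: nbhs_singleton A0.
  move/nbhs_ballP: A0 => [e /= e0 eA].
  apply: filterS (near_infty_natSinv_lt (PosNum e0)) => i /= ie.
  apply/eA/ballE.
  by rewrite /dist/= eqxx gt_max ie e0.
(* This radius is at most 1, so the ball contains no off-diagonal unit, and it
   contains [(i, i)] only when [n < i]. *)
apply/nbhs_ballP; exists n.+1%:R^-1; first by rewrite /= invr_gt0 ltr0n.
case=> [[i j]|] // /ballE.
rewrite /dist/= gt_max => /andP[_]; case: eqP => [<-|_].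
  by rewrite ltf_pV2 ?posrE ?ltr0n// ltr_nat ltnS => /ltnW ni; apply: An.
by rewrite ltNge invf_le1 ?ltr0n// ler1n.
Qed.

Lemma nbhs_zero_idempotents : nbhs (None : S) (idempotents S).
Proof.
apply/nbhs_zero; split; first by apply/idempotentsP; left.
by apply: nearW => i; apply/idempotentsP; right; exists i.
Qed.

(** Near two units there is nothing to prove. A unit [(k, l)] kills all
    diagonal units [(i, i)] with [i] large, on either side, so products near
    [(0, unit)] are eventually zero. Near [(0, 0)] one multiplies diagonal
    units, and the product of two of these is one of them or zero. *)
Lemma matrix_units_mul_continuous :
  continuous (fun x : S * S => (x.1 * x.2)%g).
Proof.
move=> [[p|] [q|]] A /= xyA.
- exists ([set Some p], [set Some q]); first by split; exact/nbhs_unit.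
  by move=> [x y] /= [-> ->]; exact: nbhs_singleton xyA.
- have A0 : A None by have := nbhs_singleton xyA; rewrite mulu0.
  exists ([set Some p], [set y : S | ((Some p : S) * y)%g = None]) => /=; last first.
    by move=> [x y] /= [-> /= ->].
  split; first exact/nbhs_unit.
  apply/nbhs_zero; split => /=; first by rewrite mulu0.
  case: p {xyA} => k l; exists l.+1 => // i /= li.
  by rewrite mul_unit ltn_eqF.
- have A0 : A None by have := nbhs_singleton xyA; rewrite mul0u.
  exists ([set x : S | (x * (Some q : S))%g = None], [set Some q]) => /=; last first.
    by move=> [x y] /= [/= H ->]; rewrite H.
  split; last exact/nbhs_unit.
  apply/nbhs_zero; split => //=.
  case: q {xyA} => k l; exists k.+1 => // i /= ki.
  by rewrite mul_unit gtn_eqF.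
- exists (A `&` idempotents S, A `&` idempotents S) => /=.
    by split; apply: filterI => //; exact: nbhs_zero_idempotents.
  move=> [x y] /= [[Ax /idempotentsP Ex] [Ay /idempotentsP Ey]].
  have A0 : A None := nbhs_singleton xyA.
  case: Ex Ax => [->|[i ->]] Ax; first by rewrite mul0u.
  case: Ey Ay => [->|[j ->]] Ay //.
  by rewrite mul_unit; case: eqP => // <-.
Qed.

Lemma matrix_units_inv_continuous : continuous (@sinv S).
Proof.
case=> [[i j]|] A /= invA.
  by apply/nbhs_unit; exact: nbhs_singleton invA.
by move/nbhs_zero: invA => H; apply/nbhs_zero.
Qed.

HB.instance Definition _ :=
  PreTopologicalSemigroup_isTopologicalSemigroup.Build S
    matrix_units_mul_continuous.

HB.instance Definition _ :=
  PreTopologicalInverseSemigroup_isTopologicalInverseSemigroup.Build S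
    matrix_units_inv_continuous.

(** * Countability, compactness and completeness *)

Lemma matrix_units_hausdorff : hausdorff_space S.
Proof. exact: (@metric_hausdorff R S). Qed.

Lemma matrix_units_countable : countable [set: S].
Proof. exact: (countableP (T := option (nat * nat))). Qed.

Lemma matrix_units_compact_idempotents : compact (idempotents S).
Proof.
apply: (@compact_almost_convergent _ _ (None : S)).
  by apply/idempotentsP; left.
move=> B /nbhs_zero[B0 [n _ Bn]].
apply: (@sub_finite_set _ _ ((fun i => Some (i, i) : S) @` `I_n)).
  move=> x [/idempotentsP[->//|[i ->]] nB]; exists i => //=.
  by rewrite ltnNge; apply/negP => ni; apply/nB/Bn.
exact/finite_image/finite_II.
Qed.

Lemma matrix_units_locally_compact : locally_compact [set: S].
Proof.
have closedK (K : set S) : compact K -> compact K /\ closed K.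
  by move=> cK; split=> //; exact: compact_closed matrix_units_hausdorff cK.
case=> [p|] _.
  exists [set Some p]; last exact/closedK/compact_set1.
  by apply: filterS (iffRL (nbhs_unit p [set Some p]) erefl) => x.
exists (idempotents S); last exact/closedK/matrix_units_compact_idempotents.
by apply: filterS nbhs_zero_idempotents => x.
Qed.

(** If a Cauchy filter does not converge to zero, it misses the ball of some
    radius [r] around zero but contains the ball of radius [r] around some [x].
    As the distance is an ultrametric, the first ball would contain the second
    if [x] had weight less than [r]; so the second ball is just [x], which is
    the limit. *)
Lemma matrix_units_complete : complete_space S.
Proof.
move=> F FF cF.
have [|nF0] := pselect (F --> (None : S)); first by exists None.
have [r r0 nFr] : exists2 r : R, 0 < r & ~ F (ball (None : S) r).
  apply: contrapT => H; apply: nF0 => A /nbhs_ballP[r /= r0 rA].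
  apply: filterS rA _; apply: contrapT => nFr.
  by apply: H; exists r.
have [x Fx] : exists x : S, F (ball x r).
  exact: (cauchyP F).1 cF r r0.
have [xr|rx] := ltP (weight x) r.
  case: nFr; apply: filterS Fx => y /ballE; rewrite /dist => xyr; apply/ballE.
  rewrite /dist; case: ifP => // _; rewrite gt_max r0 /=.
  by case: eqP xyr => [<-//|_]; rewrite gt_max => /andP[].
exists x => A /nbhs_singleton Ax; apply: filterS Fx => y /ballE.
by rewrite /dist; case: eqP => [<-//|_]; rewrite gt_max ltNge rx.
Qed.

Lemma matrix_units_polish : polish R S.
Proof.
exists S; split.
- exists setT; first exact: matrix_units_countable.
  by move=> O [x Ox] _; exists x.
- exact: matrix_units_complete.
- by exists id, id; split=> // x; exact: cvg_id.
Qed.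

(** * The obstruction to an embedding *)

(** The off-diagonal units [u n] stay outside the open set of idempotents,
    although multiplication forces their images to converge to the image of
    zero. *)
Lemma matrix_units_not_embeddable : ~ topologically_embeddable S natnat.
Proof.
move=> [phi [phiI phiC [psi [psiK psiC]]]].
have psiE x (xr : phi x \in range phi) : psi (SigSub xr) = x.
  by apply: phiI; rewrite psiK.
have phir x : phi x \in range phi by apply/mem_set; exists x.
pose e n : S := Some (n, n); pose u n : S := Some (n, n.+1).
have e0 : e @ \oo --> (None : S) by move=> A /nbhs_zero[].
have eu n : (e n * u n)%g = u n by rewrite mul_unit eqxx.
have phiu : phi (u n) @[n --> \oo] --> phi None.
  rewrite (_ : (fun n => phi (u n)) = fun n => (phi (e n) * phi (u n))%g).
    apply: natnat_cvg_absorb.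
      exact: (cvg_comp _ _ e0 (phiC None)).
    by move=> n; rewrite -gmulfM mul0u.
  by apply/funext => n; rewrite -gmulfM eu.
have : nbhs (SigSub (phir None) : range phi) (psi @^-1` idempotents S).
  by apply: psiC; rewrite psiE; exact: nbhs_zero_idempotents.
case=> _ [[V oV <-] V0 VE].
have [N _ /(_ N (leqnn N)) VN] : \forall n \near \oo, V (phi (u n)).
  by apply: phiu; apply: open_nbhs_nbhs; split.
have := VE (SigSub (phir (u N))) VN.
rewrite /= psiE => /idempotentsP[//|[i []]] -> /eqP.
by rewrite (gtn_eqF (ltnSn i)).
Qed.

End matrix_units.

Theorem proposition4p9 (R : realType) :
  exists S : topologicalInverseSemigroupType,
    countable [set: S] /\
    congruence_free S /\
    hausdorff_space S /\
    locally_compact [set: S] /\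
    polish R S /\
    compact (idempotents S) /\
    ~ topologically_embeddable S natnat.
Proof.
exists (matrix_units R).
split; first exact: matrix_units_countable.
split; first exact: matrix_units_congruence_free.
split; first exact: matrix_units_hausdorff.
split; first exact: matrix_units_locally_compact.
split; first exact: matrix_units_polish.
split; first exact: matrix_units_compact_idempotents.
exact: matrix_units_not_embeddable.
Qed.
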